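(* Let $A$ be a $C^*$-algebra. If $a$ and $b$ are normal elements of $A$, and if $0$ is the only possible accumulation point of $\sigma(a)$ (i.e. $\sigma(a)$ has no accumulation point other than possibly $0$), then $d(a,b)=0$ if and only if $a=b$.
   Context: All algebras are over $\mathbb{C}$ and have a unit $1$; $\sigma(x)$ is the spectrum of $x\in A$. For $a,b\in A$ let $C_{a,b}:A\to A$ be the bounded operator $C_{a,b}x=ax-xb$, put $\rho(a,b)=\limsup_{n\to\infty}\|C_{a,b}^n1\|^{1/n}$ and $d(a,b)=\max\{\rho(a,b),\rho(b,a)\}$. *)

(* Defs.v *)
From HB Require Import structures.
From mathcomp Require Import all_boot all_order all_algebra.
From mathcomp Require Import complex.
From mathcomp Require Import all_classical all_reals all_analysis.

Set Implicit Arguments.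
Unset Strict Implicit.
Unset Printing Implicit Defensive.

Import Order.TTheory GRing.Theory Num.Theory.
Import numFieldNormedType.Exports.
Local Open Scope classical_set_scope.
Local Open Scope ring_scope.
Local Open Scope complex_scope.

(* HB cannot join algType with normed modules (numDomainType already lies below
   both), so the product is a field of the mixin; the algType R[i] structure of
   a C*-algebra is declared as an instance after the structure. *)
HB.mixin Record CompleteNormedModule_isCStar (R : realType) A
    of CompleteNormedModule R[i] A := {
  cstar_one : A;
  cstar_mul : A -> A -> A;
  star : A -> A;
  cstar_mulA : associative cstar_mul;
  cstar_mul1l : left_id cstar_one cstar_mul;
  cstar_mul1r : right_id cstar_one cstar_mul;
  cstar_mulDl : left_distributive cstar_mul +%R;
  cstar_mulDr : right_distributive cstar_mul +%R;
  cstar_scaleAl : forall (z : R[i]) (x y : A),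
    z *: cstar_mul x y = cstar_mul (z *: x) y;
  cstar_scaleAr : forall (z : R[i]) (x y : A),
    z *: cstar_mul x y = cstar_mul x (z *: y);
  cstar_one_neq0 : cstar_one != 0;
  cstar_normM : forall x y : A, `|cstar_mul x y| <= `|x| * `|y|;
  starK : involutive star;
  starD : {morph star : x y / x + y};
  starZ : forall (z : R[i]) (x : A), star (z *: x) = z^* *: star x;
  starM : forall x y : A, star (cstar_mul x y) = cstar_mul (star y) (star x);
  cstar_identity : forall x : A, `|cstar_mul (star x) x| = `|x| ^+ 2
}.

#[short(type="cstarAlgType")]
HB.structure Definition CStarAlgebra (R : realType) :=
  { A of CompleteNormedModule R[i] A & CompleteNormedModule_isCStar R A }.

HB.instance Definition _ (R : realType) (A : cstarAlgType R) :=
  GRing.Zmodule_isNzRing.Build (CStarAlgebra.sort A)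
    (@cstar_mulA R A) (@cstar_mul1l R A) (@cstar_mul1r R A)
    (@cstar_mulDl R A) (@cstar_mulDr R A) (@cstar_one_neq0 R A).

#[non_forgetful_inheritance]
HB.instance Definition _ (R : realType) (A : cstarAlgType R) :=
  GRing.Lmodule_isLalgebra.Build R[i] (CStarAlgebra.sort A) (@cstar_scaleAl R A).

#[non_forgetful_inheritance]
HB.instance Definition _ (R : realType) (A : cstarAlgType R) :=
  GRing.Lalgebra_isAlgebra.Build R[i] (CStarAlgebra.sort A) (@cstar_scaleAr R A).

Definition invertible (A : nzRingType) (x : A) : Prop :=
  exists y : A, x * y = 1 /\ y * x = 1.

(* R[i]^o, not R[i], carries the topology of the complex plane. *)
Definition spectrum (R : realType) (A : algType R[i]) (a : A) : set R[i]^o :=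
  [set z | ~ invertible (z%:A - a)].

Definition normal (R : realType) (A : cstarAlgType R) (a : A) : Prop :=
  a * star a = star a * a.

(* `|x| is a nonnegative real number, but of type R[i]. *)
Definition rnorm (R : realType) (A : cstarAlgType R) (x : A) : R :=
  complex.Re `|x|.

Definition C_op (A : nzRingType) (a b : A) (x : A) : A := a * x - x * b.

(* The term n = 0, where 0^-1 = 0, does not affect the limsup. *)
Definition rho (R : realType) (A : cstarAlgType R) (a b : A) : \bar R :=
  limn_esup (fun n : nat =>
    (rnorm (iter n (C_op a b) 1) `^ (n%:R^-1))%:E).

Definition quasi_dist (R : realType) (A : cstarAlgType R) (a b : A) : \bar R :=
  Order.max (rho a b) (rho b a).

(* Main.v *)
Require Import Defs.
From HB Require Import structures.
From mathcomp Require Import all_boot all_order all_algebra.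
From mathcomp Require Import complex.
From mathcomp Require Import all_classical all_reals all_analysis.
From mathcomp Require Import ring lra.

(** If [d(a, b) = 0] then [a] and [b] have the same solutions of
    [a x = z x] and nearly the same small part, and the spectral hypothesis
    decomposes the unit into such solutions and a small remainder.

    Transfer of growth.  Put [D_k = C_{b,a}^k 1].  From
    [b D_k a^j = D_{k+1} a^j + D_k a^{j+1}] the norm of [b^n x] is bounded by
    [M K (t + d)^n] as soon as [|D_k| <= M d^k] and [|a^k x| <= K t^k].  Since
    [rho b a = 0], [d] can be taken arbitrarily small, and since [b] is normal
    the sequence [|b^n x|] is log-convex, so its first ratio is bounded by its
    growth rate: [|b x| <= t |x|] (growth_transfer).  Applied to [a - z] and
    [b - z] with [t = 0], this says that [a x = z x] implies [b x = z x].

    Splitting of the unit.  Fix [e > 0].  Only finitely many spectral points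
    [l] of [a] have [|l| >= e], and the others lie in a smaller disc
    [|w| <= e' < e].  On the spectrum the polynomials [prod_l (1 - (w / l)^n)]
    vanish at each [l] and converge uniformly to [1] on the smaller disc.  As
    the norm of a polynomial in [a] is bounded by its supremum on the spectrum,
    their values at [a] converge to some [p] with [|a^k p| <= e^k], while
    [1 - p] is annihilated by [prod_l (a - l)] (spectral_splitting).  By
    Bezout, [1 - p] is a sum of solutions of [a x = l x], so
    [(a - b)(1 - p) = 0]; and [|a p|], [|b p|] are at most [e] by transfer.
    Hence [|a - b| <= 2 e].

    The supremum bound rests on the fact that the norm of a normal element is
    its spectral radius.  If [|x| = 1] and no [1 - z x] with [|z| <= 1] were
    singular, the resolvents of [x] and of [r x], with [r < 1] close to [1],
    would be uniformly close on the unit circle, and averaging over the two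
    square roots of each point of the circle transports this closeness to
    [x^2] and [(r x)^2], and so on to [x^(2^m)] and [(r x)^(2^m)].  The latter
    tends to [0] while the former has norm [1], which is impossible
    (normal_unit_resolvent). *)

Set Implicit Arguments.
Unset Strict Implicit.
Unset Printing Implicit Defensive.

Import Order.TTheory GRing.Theory Num.Theory.
Import numFieldNormedType.Exports.
Local Open Scope classical_set_scope.
Local Open Scope ring_scope.
Local Open Scope complex_scope.

(** * Real-valued modulus and norm *)

(** The modulus as an element of [R]: the order of [R[i]] is only partial, so
    estimates are carried out in [R]. *)
Definition cabs (R : realType) (z : R[i]) : R := complex.Re `|z|.

Section Modulus.
Context (R : realType).
Implicit Types z w : R[i].

Lemma normc_cabs z : `|z| = (cabs z)%:C.
Proof. by rewrite /cabs RRe_real// normr_real. Qed.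

Lemma cabs_ge0 z : 0 <= cabs z.
Proof. by rewrite -lecR -normc_cabs normr_ge0. Qed.

Lemma cabsM z w : cabs (z * w) = cabs z * cabs w.
Proof. by apply: complexI; rewrite rmorphM /= -!normc_cabs normrM. Qed.

Lemma cabsN z : cabs (- z) = cabs z.
Proof. by rewrite /cabs normrN. Qed.

Lemma cabsD z w : cabs (z + w) <= cabs z + cabs w.
Proof. by rewrite -lecR rmorphD /= -!normc_cabs ler_normD. Qed.

Lemma cabsB z w : cabs (z - w) <= cabs z + cabs w.
Proof. by rewrite -(cabsN w) cabsD. Qed.

Lemma cabsBC z w : cabs (z - w) = cabs (w - z).
Proof. by rewrite -cabsN opprB. Qed.

Lemma cabs0 : cabs (0 : R[i]) = 0.
Proof. by rewrite /cabs normr0. Qed.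

Lemma cabs1 : cabs (1 : R[i]) = 1.
Proof. by rewrite /cabs normr1. Qed.

Lemma cabs_eq0 z : (cabs z == 0) = (z == 0).
Proof.
by rewrite -(inj_eq (@complexI R)) -normc_cabs /= [RHS](esym (normr_eq0 _)).
Qed.

Lemma cabs_gt0 z : (0 < cabs z) = (z != 0).
Proof. by rewrite lt0r cabs_ge0 andbT cabs_eq0. Qed.

Lemma cabsX z n : cabs (z ^+ n) = cabs z ^+ n.
Proof. by elim: n => [|n IH]; rewrite ?cabs1// !exprS cabsM IH. Qed.

Lemma cabsV z : cabs z^-1 = (cabs z)^-1.
Proof.
by apply: complexI; rewrite -normc_cabs normfV normc_cabs fmorphV.
Qed.

Lemma cabs_real (x : R) : cabs x%:C = `|x|.
Proof.
by apply: complexI; rewrite -normc_cabs normc_def /= expr0n addr0 sqrtr_sqr.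
Qed.

End Modulus.

Section Norm.
Context (R : realType) (A : cstarAlgType R).
Implicit Types x y : A.
Local Notation nrm := (@rnorm R A).

Lemma norm_rnorm x : `|x| = (nrm x)%:C.
Proof. by rewrite /rnorm RRe_real// ger0_real. Qed.

Lemma rnorm_ge0 x : 0 <= nrm x.
Proof. by rewrite -lecR -norm_rnorm normr_ge0. Qed.

Lemma rnormD x y : nrm (x + y) <= nrm x + nrm y.
Proof. by rewrite -lecR rmorphD /= -!norm_rnorm ler_normD. Qed.

Lemma rnormN x : nrm (- x) = nrm x.
Proof. by rewrite /rnorm normrN. Qed.

Lemma rnormB x y : nrm (x - y) <= nrm x + nrm y.
Proof. by rewrite -(rnormN y) rnormD. Qed.

Lemma rnorm0 : nrm 0 = 0.
Proof. by rewrite /rnorm normr0. Qed.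

Lemma rnorm_eq0 x : (nrm x == 0) = (x == 0).
Proof.
by rewrite -(inj_eq (@complexI R)) -norm_rnorm /= [RHS](esym (normr_eq0 _)).
Qed.

Lemma rnorm_le0 x : nrm x <= 0 -> x = 0.
Proof. by move=> h; apply/eqP; rewrite -rnorm_eq0 eq_le h rnorm_ge0. Qed.

Lemma rnormM x y : nrm (x * y) <= nrm x * nrm y.
Proof. by rewrite -lecR rmorphM /= -!norm_rnorm; exact: cstar_normM. Qed.

Lemma rnormZ (z : R[i]) x : nrm (z *: x) = cabs z * nrm x.
Proof.
by apply: complexI; rewrite rmorphM /= -normc_cabs -!norm_rnorm normrZ.
Qed.

Lemma rnorm_star_mul x : nrm (star x * x) = nrm x ^+ 2.
Proof.
by apply: complexI; rewrite rmorphXn /= -!norm_rnorm; exact: cstar_identity.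
Qed.

Lemma star_mul x y : star (x * y) = star y * star x.
Proof. exact: starM. Qed.

Lemma star1 : star (1 : A) = 1.
Proof.
by rewrite -[LHS]mulr1 -[X in _ * X](starK 1) -star_mul mulr1 starK.
Qed.

Lemma rnorm1 : nrm 1 = 1.
Proof.
have := rnorm_star_mul 1; rewrite star1 mulr1 => h.
have n0 : nrm 1 != 0 by rewrite rnorm_eq0 oner_neq0.
by apply: (mulfI n0); rewrite mulr1 {3}h expr2.
Qed.

(** * Normal elements and growth of powers *)

Lemma normal_rnorm (a x : A) : normal a -> nrm (star a * x) = nrm (a * x).
Proof.
move=> ha; apply/eqP; rewrite -(eqrXn2 (n := 2)) ?rnorm_ge0//.
by rewrite -!rnorm_star_mul !star_mul starK !mulrA -(mulrA _ a) ha -!mulrA.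
Qed.

(** [|a x|^2 = |x* a* (a x)|], and the adjoint of a normal element may be
    replaced by the element itself inside a norm. *)
Lemma rnorm_log_convex (a x : A) : normal a ->
  nrm (a * x) ^+ 2 <= nrm (a * (a * x)) * nrm x.
Proof.
move=> ha; rewrite -rnorm_star_mul star_mul -mulrA.
have h : nrm (star x) <= nrm x.
  have := rnorm_star_mul (star x); rewrite starK => e.
  have := rnormM x (star x); rewrite e expr2.
  have [/eqP|] := eqVneq (nrm (star x)) 0.
    by rewrite rnorm_eq0 => /eqP ->; rewrite rnorm0 rnorm_ge0.
  by move=> n0; rewrite ler_pM2r// lt0r n0 rnorm_ge0.
apply: (le_trans (rnormM _ _)); rewrite normal_rnorm// mulrC.
by rewrite ler_wpM2l ?rnorm_ge0.
Qed.

(** By log-convexity the ratios of consecutive [|a^k x|] increase, hence all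
    are at least the first one, [|a x| / |x|]. *)
Lemma rnorm_power_ge (a x : A) n : normal a ->
  nrm (a * x) ^+ n * nrm x <= nrm (a ^+ n * x) * nrm x ^+ n.
Proof.
move=> ha; have pow k : a ^+ k.+1 * x = a * (a ^+ k * x) by rewrite exprS mulrA.
have ratio k : nrm (a * x) * nrm (a ^+ k * x) <= nrm (a ^+ k.+1 * x) * nrm x.
  elim: k => [|k IH]; first by rewrite expr0 expr1 mul1r.
  have c := rnorm_log_convex (a ^+ k * x) ha.
  rewrite -!pow in c.
  have [/eqP z|n0] := eqVneq (nrm (a ^+ k * x)) 0.
    rewrite rnorm_eq0 in z; rewrite [a ^+ k.+1 * x]pow (eqP z) mulr0 rnorm0.
    by rewrite mulr0 mulr_ge0 ?rnorm_ge0.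
  have p0 : 0 < nrm (a ^+ k * x) by rewrite lt0r n0 rnorm_ge0.
  rewrite -(ler_pM2r p0).
  have h1 := ler_wpM2l (rnorm_ge0 (a ^+ k.+1 * x)) IH.
  have h2 := ler_wpM2r (rnorm_ge0 x) c.
  lra.
elim: n => [|n IH]; first by rewrite !expr0 !mul1r mulr1.
have h1 := ler_wpM2l (rnorm_ge0 (a * x)) IH.
have h2 := ler_wpM2r (exprn_ge0 n (rnorm_ge0 x)) (ratio n).
rewrite [nrm (a * x) ^+ _]exprS [nrm x ^+ _]exprS; lra.
Qed.

End Norm.

(** * Transfer of growth along commutators *)

Section Growth.
Context (R : realType).

Lemma expr_eventually_lt (r e : R) : 0 <= r < 1 -> 0 < e ->
  exists N, forall n, (N <= n)%N -> r ^+ n < e.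
Proof.
move=> /andP[r0 r1] e0.
have /cvgrPdist_lt/(_ e e0)[N _ hN] : (r ^+ n @[n --> \oo] --> (0 : R)).
  by apply: cvg_expr; rewrite ger0_norm.
exists N => n Nn; have := hN n Nn.
by rewrite /= sub0r normrN ger0_norm// exprn_ge0.
Qed.

Lemma growth_le (q s c C : R) : 0 <= q -> 0 < s -> 0 < c ->
  (forall n, q ^+ n * c <= C * s ^+ n) -> q <= s.
Proof.
move=> q0 s0 c0 h; rewrite leNgt; apply/negP => sq.
have q1 : 0 < q by exact: lt_trans sq.
have C0 : 0 < C by have := h 0; rewrite !expr0; lra.
have [||N /(_ N (leqnn N))] := @expr_eventually_lt (s / q) (c / C).
- by rewrite divr_ge0 ?ltr_pdivrMr ?mul1r ?ltW.
- by rewrite divr_gt0.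
rewrite expr_div_n ltr_pdivlMr// mulrAC ltr_pdivrMr ?exprn_gt0//.
by have := h N; lra.
Qed.

End Growth.

(** What a nonpositive [rho b a] provides: [C_{b,a}^n 1] decays faster than
    every geometric sequence. *)
Definition subgeometric_commutators
    (R : realType) (A : cstarAlgType R) (b a : A) :=
  forall d : R, 0 < d -> exists M : R, forall n,
    rnorm (iter n (C_op b a) 1) <= M * d ^+ n.

Section Transfer.
Context (R : realType) (A : cstarAlgType R).
Implicit Types (a b x : A).
Local Notation nrm := (@rnorm R A).

Lemma rho_le0_subgeometric b a : (rho b a <= 0)%E ->
  subgeometric_commutators b a.
Proof.
move=> h d d0.
have : (rho b a < d%:E)%E by apply: le_lt_trans h _; rewrite lte_fin.
rewrite /rho /limn_esup /limf_esup => /ereal_inf_lt[_ [V [N _ NV] <-]] hV.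
set D := fun n => nrm (iter n (C_op b a) 1).
have D0 n : 0 <= D n by exact: rnorm_ge0.
have big n : (N < n)%N -> D n <= d ^+ n.
  move=> Nn; have : (((D n `^ n%:R^-1)%:E) < d%:E)%E.
    apply: le_lt_trans hV; apply: ereal_sup_ubound; exists n => //.
    by apply: NV => /=; exact: ltnW.
  rewrite lte_fin => /ltW/(lerXn2r n).
  rewrite !nnegrE powR_ge0 ltW// => /(_ isT isT).
  rewrite -(powR_mulrn n (powR_ge0 _ _)) -powRrM mulVf ?powRr1//.
  by rewrite pnatr_eq0 -lt0n (leq_ltn_trans _ Nn).
(* The sum absorbs the finitely many indices not covered by [big]. *)
exists (1 + \sum_(k < N.+1) D k / d ^+ k) => n.
have S0 : 0 <= \sum_(k < N.+1) D k / d ^+ k.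
  by apply: sumr_ge0 => k _; rewrite divr_ge0// exprn_ge0// ltW.
have [nN|Nn] := leqP n.+1 N.+1; last first.
  apply: le_trans (big n Nn) _.
  by rewrite ler_peMl ?lerDl// exprn_ge0// ltW.
rewrite -ler_pdivrMr ?exprn_gt0// (bigD1 (Ordinal nN))//= addrCA lerDl.
rewrite addr_ge0//; apply: sumr_ge0 => k _.
by rewrite divr_ge0// exprn_ge0// ltW.
Qed.

(** Left multiplication by [b] is the sum of [C_{b,a}] and of right
    multiplication by [a], which commute, so [b^n x] is controlled by the
    products [(C_{b,a}^k 1) a^j x]; log-convexity turns the growth rate of
    [|b^n x|] into a bound on its first step. *)
Lemma growth_transfer a b x t K : normal b -> subgeometric_commutators b a ->
  0 <= t -> (forall k, nrm (a ^+ k * x) <= K * t ^+ k) ->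
  nrm (b * x) <= t * nrm x.
Proof.
move=> nb ba t0 hK.
have [/eqP|x0] := eqVneq (nrm x) 0.
  by rewrite rnorm_eq0 => /eqP ->; rewrite mulr0 rnorm0 mulr0.
have xp : 0 < nrm x by rewrite lt0r x0 rnorm_ge0.
rewrite -ler_pdivrMr//; apply/ler_addgt0Pr => d d0.
have [M hM] := ba d d0.
have M0 : 0 <= M.
  by have := hM 0; rewrite expr0 mulr1; apply: le_trans; exact: rnorm_ge0.
(* Induction with all [k], [j] at once avoids expanding the binomial sum. *)
have bound n : forall k j,
    nrm (b ^+ n * (iter k (C_op b a) 1 * (a ^+ j * x))) <=
    M * K * d ^+ k * t ^+ j * (t + d) ^+ n.
  elim: n => [|n IH] k j.
    rewrite expr0 mul1r mulr1; apply: le_trans (rnormM _ _) _.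
    have := ler_pM (rnorm_ge0 _) (rnorm_ge0 _) (hM k) (hK j).
    by move/le_trans; apply; rewrite -!mulrA ler_wpM2l// mulrCA.
  have -> : b ^+ n.+1 * (iter k (C_op b a) 1 * (a ^+ j * x)) =
      b ^+ n * (iter k.+1 (C_op b a) 1 * (a ^+ j * x)) +
      b ^+ n * (iter k (C_op b a) 1 * (a ^+ j.+1 * x)).
    have -> : iter k.+1 (C_op b a) 1 =
      b * iter k (C_op b a) 1 - iter k (C_op b a) 1 * a by [].
    rewrite exprSr -mulrDr -mulrA; congr (_ * _).
    by rewrite mulrBl exprS !mulrA subrK.
  apply: le_trans (rnormD _ _) _; apply: le_trans (lerD (IH _ _) (IH _ _)) _.
  by rewrite !exprS; lra.
apply: (@growth_le _ _ _ (nrm x) (M * K)); rewrite ?divr_ge0 ?rnorm_ge0//.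
  by rewrite ltr_wpDl.
move=> n; have := bound n 0 0; rewrite !expr0 /= mul1r !mulr1 mul1r => hn.
have := rnorm_power_ge x n nb => hp.
rewrite expr_div_n mulrAC ler_pdivrMr ?exprn_gt0//.
by apply: le_trans hp _; rewrite ler_wpM2r// exprn_ge0// rnorm_ge0.
Qed.

Lemma C_op_shift b a (z : R[i]) : C_op (b - z%:A) (a - z%:A) =1 C_op b a.
Proof.
move=> x; rewrite /C_op mulrBl mulrBr -scalerAl mul1r -scalerAr mulr1.
by rewrite opprB addrA subrK.
Qed.

Lemma subgeometric_shift b a (z : R[i]) :
  subgeometric_commutators b a -> subgeometric_commutators (b - z%:A) (a - z%:A).
Proof.
move=> h d /h[M hM]; exists M => n; congr (_ <= _): (hM n).
by congr nrm; apply: eq_iter => x; rewrite C_op_shift.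
Qed.

Lemma star_scalar (z : R[i]) : star (z%:A : A) = z^*%:A.
Proof. by rewrite starZ star1. Qed.

Lemma starB a b : star (a - b) = star a - star b.
Proof.
by rewrite starD -[in RHS]scaleN1r -[- b]scaleN1r starZ rmorphN rmorph1.
Qed.

Lemma normal_shift a (z : R[i]) : normal a -> normal (a - z%:A).
Proof.
move=> ha; rewrite /normal starB star_scalar.
rewrite !mulrBl !mulrBr -!scalerAl -!scalerAr !mulr1 !mul1r ha.
rewrite !opprB !addrA !scalerA (mulrC z).
by rewrite [LHS]addrAC [RHS]addrAC; congr (_ + _); rewrite addrAC.
Qed.

(** The case [t = 0] of the transfer, for [a - z] and [b - z]. *)
Lemma eigen_transfer a b x (z : R[i]) : normal b ->
  subgeometric_commutators b a -> a * x = z *: x -> b * x = z *: x.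
Proof.
move=> nb ba ax; apply/eqP; rewrite -subr_eq0; apply/eqP.
have <- : (b - z%:A) * x = b * x - z *: x.
  by rewrite mulrBl -scalerAl mul1r.
apply: rnorm_le0.
have := @growth_transfer (a - z%:A) (b - z%:A) x 0 (nrm x)
  (normal_shift z nb) (subgeometric_shift z ba) (lexx 0).
rewrite mul0r; apply => -[|k]; first by rewrite !expr0 mul1r mulr1.
rewrite exprSr -mulrA mulrBl -scalerAl mul1r ax subrr mulr0 rnorm0.
by rewrite exprS mul0r mulr0.
Qed.

End Transfer.

(** * Compactness in the complex plane *)

Section Plane.
Context (R : realType).
Implicit Types (z w : R[i]) (S : set R[i]^o).

Lemma nbhs_cabsP (z : R[i]^o) S :
  nbhs z S <-> exists2 e : R, 0 < e & forall w, cabs (z - w) < e -> S w.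
Proof.
split=> [/nbhs_ballP[e /= e0 h]|[e e0 h]].
  have er : e = (complex.Re e)%:C by rewrite RRe_real// gtr0_real.
  exists (complex.Re e) => [|w zw]; first by rewrite -ltcR -er.
  by apply: h; rewrite -ball_normE /= normc_cabs er ltcR.
apply/nbhs_ballP; exists e%:C => /=; first by rewrite ltcR.
by move=> w; rewrite -ball_normE /= normc_cabs ltcR => /h.
Qed.

Lemma cabs_dist z w : `|cabs z - cabs w| <= cabs (z - w).
Proof.
rewrite ler_norml; apply/andP; split.
  have := cabsD (w - z) z; rewrite subrK cabsBC; lra.
by have := cabsD (z - w) w; rewrite subrK; lra.
Qed.

Lemma cabsi : cabs ('i : R[i])%C = 1.
Proof. by rewrite /cabs normc_def /= expr0n expr1n add0r sqrtr1. Qed.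

Lemma cabs_le_ReIm z : cabs z <= `|complex.Re z| + `|complex.Im z|.
Proof.
rewrite {1}(complexE z); apply: le_trans (cabsD _ _) _.
by rewrite cabsM !cabs_real cabsi mul1r.
Qed.

Lemma Re_le_cabs z : `|complex.Re z| <= cabs z.
Proof. by rewrite -lecR -normc_cabs normc_ge_Re. Qed.

Lemma Im_le_cabs z : `|complex.Im z| <= cabs z.
Proof.
rewrite -[cabs z]mul1r -cabsi -cabsM; apply: le_trans (Re_le_cabs _).
by case: z => x y /=; rewrite mul0r mul1r sub0r normrN.
Qed.

(** The disc is closed inside the image of a compact real square. *)
Lemma disc_compact (r : R) : compact [set z : R[i]^o | cabs z <= r].
Proof.
pose f (p : R * R) : R[i]^o := (p.1 +i* p.2)%C.
have cf : continuous f.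
  move=> p S /nbhs_cabsP[e e0 h]; rewrite /nbhs /=.
  have e2 : 0 < e / 2 by rewrite divr_gt0.
  exists (ball p.1 (e / 2), ball p.2 (e / 2)).
    by split; exact: nbhsx_ballx.
  move=> -[x y] [/= hx hy]; apply: h.
  apply: le_lt_trans (cabs_le_ReIm _) _.
  by rewrite (splitr e) ltrD.
have /(continuous_compact (continuous_subspaceT cf)) sq :
    compact (`[- r, r]%classic `*` `[- r, r]%classic : set (R * R)).
  by apply: compact_setX; exact: segment_compact.
apply: subclosed_compact sq _.
  have cc : continuous (@cabs R : R[i]^o -> R).
    move=> z S /nbhs_ballP[e /= e0 h]; apply/nbhs_cabsP; exists e => // w zw.
    by apply: h; rewrite -ball_normE /=; apply: le_lt_trans zw; exact: cabs_dist.
  apply: (@preimage_closed _ _ (@cabs R : R[i]^o -> R) [set x | x <= r]) => //;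
    exact: closed_le.
move=> z /= zr; exists (complex.Re z, complex.Im z); last by case: z zr.
have h1 := le_trans (Re_le_cabs z) zr; have h2 := le_trans (Im_le_cabs z) zr.
by rewrite /= !in_itv /= -!ler_norml h1 h2.
Qed.

(** Cover the disc by open sets each containing at most one point of
    [S] of modulus at least [e], and extract a finite subcover. *)
Lemma finite_off_limit_points S (r e : R) : 0 < e ->
  (forall w, S w -> cabs w <= r) -> limit_point S `<=` [set 0] ->
  exists s : seq R[i], forall w, S w -> e <= cabs w -> w \in s.
Proof.
move=> e0 Sr Sl.
have := @disc_compact r; rewrite compact_cover => /(_ R[i]^o setT
  (fun z => interior [set w | S w -> e <= cabs w -> w = z])) [].
- by move=> z _; exact: open_interior.
- move=> z _; exists z => //=.
  have [->|z0] := eqVneq z 0.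
    apply/nbhs_cabsP; exists e => // w; rewrite sub0r cabsN => we _.
    by rewrite leNgt we.
  have : ~ limit_point S z by move=> /Sl /= /eqP; rewrite (negbTE z0).
  rewrite not_limit_pointE => -[X Xz XS]; rewrite /interior /=.
  apply: filterS Xz => w Xw Sw _.
  exact: XS.
move=> D _ Dcov; exists (finmap.enum_fset D) => w Sw ew.
have [z zD /interior_subset /= /(_ Sw ew) ->] := Dcov w (Sr _ Sw).
exact: zD.
Qed.

End Plane.

(** * Spectral radius of a normal element *)

Definition inverses (A : nzRingType) (u y : A) := u * y = 1 /\ y * u = 1.

Lemma subBB (V : zmodType) (t p q : V) : (t - p) - (t - q) = q - p.
Proof. by rewrite opprB addrC addrA subrK. Qed.

Lemma inverses_sub (A : nzRingType) (u y v w : A) :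
  inverses u y -> inverses v w -> y - w = y * (v - u) * w.
Proof.
by move=> [uy yu] [vw wv]; rewrite mulrBr yu mulrBl mul1r -mulrA vw mulr1.
Qed.

Section SpectralRadius.
Context (R : realType) (A : cstarAlgType R).
Implicit Types (a x y : A).
Local Notation nrm := (@rnorm R A).

(** If [y0] inverts [1 - z0 x], the resolvent identity bounds the inverses of
    [1 - z x] by [2 |y0|] for [z] near [z0]; the disc is compact. *)
Lemma resolvent_bounded x :
  (forall z : R[i], cabs z <= 1 -> invertible (1 - z *: x)) ->
  exists K, forall (z : R[i]) y,
    cabs z <= 1 -> inverses (1 - z *: x) y -> nrm y <= K.
Proof.
move=> h; pose P M (z : R[i]^o) := forall y, inverses (1 - z *: x) y -> nrm y <= M.
suff near_disc : forall z0 : R[i]^o, [set z : R[i]^o | cabs z <= 1] z0 ->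
    \forall z \near z0 & M \near +oo%R, P M z.
  have [N [_ hN]] := proj1 (compact_near_coveringP _) (@disc_compact R 1)
    R +oo%R P _ near_disc.
  have N1 : N < N + 1 by rewrite ltrDl.
  by exists (N + 1) => z y z1; exact: (hN _ N1 z z1).
move=> z0 /= z01.
have [y0 iy0] := h z0 z01.
(* For [|z0 - z| < 1 / c] the correction term is at most [|y| / 2]. *)
pose c := 2 * (1 + nrm x) * (1 + nrm y0).
have x0 := rnorm_ge0 x; have p0 := rnorm_ge0 y0.
have c0 : 0 < c by rewrite !mulr_gt0// ltr_wpDr.
exists ([set z | cabs (z0 - z) < c^-1], [set M | 2 * nrm y0 < M]).
  split; last by exists (2 * nrm y0); split; rewrite ?num_real.
  by apply/nbhs_cabsP; exists c^-1 => //; rewrite invr_gt0.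
move=> [z M] /= [zc hM] y iy.
have := inverses_sub iy iy0.
rewrite subBB -scalerBl => e.
have e1 : nrm (y - y0) <= nrm y * (cabs (z - z0) * nrm x) * nrm y0.
  rewrite e; apply: le_trans (rnormM _ _) _; rewrite ler_wpM2r//.
  by apply: le_trans (rnormM _ _) _; rewrite rnormZ.
have e2 : cabs (z - z0) * (nrm x * nrm y0) <= 2^-1.
  apply: le_trans (_ : c^-1 * (nrm x * nrm y0) <= _).
    rewrite ler_wpM2r ?mulr_ge0//.
    by rewrite cabsBC ltW.
  rewrite mulrC ler_pdivrMr// /c.
  have := mulr_ge0 x0 p0; lra.
have := rnormD (y - y0) y0; rewrite subrK.
have := ler_wpM2l (rnorm_ge0 y) e2; lra.
Qed.

Definition close_resolvents (e : R) x y := forall w : R[i], cabs w = 1 ->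
  exists u v, [/\ inverses (1 - w *: x) u, inverses (1 - w *: y) v &
                  nrm (u - v) <= e].

(** The partial fraction [2 / (1 - t^2) = 1 / (1 - t) + 1 / (1 + t)]. *)
Lemma inverses_sqr (w : R[i]) x u v :
  inverses (1 - w *: x) u -> inverses (1 - (- w) *: x) v ->
  inverses (1 - w ^+ 2 *: x ^+ 2) (2^-1 *: (u + v)).
Proof.
rewrite scaleNr opprK => -[xu ux] [xv vx].
have e1 : 1 - w ^+ 2 *: x ^+ 2 = (1 + w *: x) * (1 - w *: x).
  by rewrite mulrBr mulr1 mulrDl mul1r -scalerAr -scalerAl scalerA -!expr2
     opprD addrA addrK.
have e2 : 1 - w ^+ 2 *: x ^+ 2 = (1 - w *: x) * (1 + w *: x).
  by rewrite mulrDr mulr1 mulrBl mul1r -scalerAr -scalerAl scalerA -!expr2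
     addrA subrK.
have half : 2^-1 *: ((1 + w *: x) + (1 - w *: x)) = 1.
  rewrite addrACA subrr addr0 -mulr2n -scalerMnr scalerMnl.
  by rewrite -[2^-1 *+ 2]mulr_natr mulVf ?scale1r//.
split.
  rewrite -scalerAr mulrDr {1}e1 e2 -!mulrA xu xv !mulr1; exact: half.
rewrite -scalerAl mulrDl {1}e2 e1 !mulrA ux vx !mul1r; exact: half.
Qed.

Lemma close_resolvents_sqr e x y :
  close_resolvents e x y -> close_resolvents e (x ^+ 2) (y ^+ 2).
Proof.
move=> h w w1; have w1' : cabs (sqrtc w) = 1.
  apply/eqP; rewrite -(eqrXn2 (n := 2)) ?cabs_ge0//.
  by rewrite expr1n -cabsX sqr_sqrtc w1.
have [u1 [v1 [iu1 iv1 d1]]] := h _ w1'.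
have [u2 [v2 [iu2 iv2 d2]]] := h (- sqrtc w) (etrans (cabsN _) w1').
exists (2^-1 *: (u1 + u2)), (2^-1 *: (v1 + v2)); split.
- by rewrite -[w]sqr_sqrtc; exact: inverses_sqr.
- by rewrite -[w]sqr_sqrtc; exact: inverses_sqr.
rewrite -scalerBr opprD addrACA rnormZ cabsV.
have -> : cabs (2 : R[i]) = 2.
  by rewrite -(rmorph_nat (real_complex R)) cabs_real normr_nat.
by have := rnormD (u1 - v1) (u2 - v2); lra.
Qed.

Lemma rnormX x n : nrm (x ^+ n) <= nrm x ^+ n.
Proof.
elim: n => [|n IH]; first by rewrite !expr0 rnorm1.
rewrite !exprS; apply: le_trans (rnormM _ _) _.
by rewrite ler_wpM2l ?rnorm_ge0.
Qed.

(** Otherwise the resolvents of [x] and [r x] stay within [1/4] of each other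
    after any number of squarings; that of [(r x)^(2^m)] tends to [1] at the
    point [1], so that of [x^(2^m)] is close to [1] there, and [x^(2^m)] would
    have norm less than [1]. *)
Lemma normal_unit_resolvent x : normal x -> nrm x = 1 ->
  ~ (forall z : R[i], cabs z <= 1 -> invertible (1 - z *: x)).
Proof.
move=> nx x1 h; have [K hK] := resolvent_bounded h.
have K0 : 0 <= K.
  have [|y iy] := h 0; first by rewrite cabs0.
  by apply: le_trans (hK 0 y _ iy); rewrite ?rnorm_ge0 ?cabs0.
(* By the resolvent identity the two resolvents differ by at most
   [(1 - r) K^2 = K^2 / c <= 1/4]. *)
pose c := 4 * (1 + K * K).
have KK : 0 <= K * K by rewrite mulr_ge0.
have c4 : 4 <= c by rewrite /c; lra.
have c0 : 0 < c by lra.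
pose r := 1 - c^-1.
have c1 : c^-1 <= 4^-1 by rewrite lef_pV2 ?posrE.
have cp : 0 < c^-1 by rewrite invr_gt0.
have r0 : 0 <= r by rewrite /r; lra.
have r1 : r < 1 by rewrite /r; lra.
have close0 : close_resolvents 4^-1 x (r%:C *: x).
  move=> w w1; have w1' : cabs w <= 1 by rewrite w1.
  have [u iu] := h w w1'.
  have wr1 : cabs (w * r%:C) <= 1.
    by rewrite cabsM w1 mul1r cabs_real ger0_norm// ltW.
  have [v iv] := h _ wr1; exists u, v; split=> //; first by rewrite scalerA.
  rewrite (inverses_sub iu iv) subBB -scalerBl -[X in X - _]mulr1 -mulrBr.
  apply: le_trans (rnormM _ _) _.
  have hu := hK _ _ w1' iu; have hv := hK _ _ wr1 iv.
  have e1 : nrm (u * ((w * (1 - r%:C)) *: x)) <= K * c^-1.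
    apply: le_trans (rnormM _ _) _; rewrite rnormZ x1 mulr1 cabsM w1 mul1r.
    rewrite -(rmorph1 (real_complex R)) -rmorphB cabs_real /r opprB addrC subrK.
    by rewrite gtr0_norm// ler_wpM2r// ltW.
  apply: le_trans (_ : (K * c^-1) * K <= _).
    by apply: ler_pM; rewrite ?rnorm_ge0.
  by rewrite mulrAC ler_pdivrMr// /c; lra.
have closem m : close_resolvents 4^-1 (x ^+ (2 ^ m)) ((r%:C *: x) ^+ (2 ^ m)).
  elim: m => [|m IH]; first by rewrite expn0 !expr1.
  by rewrite expnS mulnC !exprM; exact: close_resolvents_sqr.
have [||N hN] := @expr_eventually_lt R r 9^-1; rewrite ?r0 ?invr_gt0//.
have {}hN := hN (2 ^ N)%N (ltnW (ltn_expl _ (isT : (1 < 2)%N))).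
have [|u [v [iu iv d]]] := closem N 1; first by rewrite cabs1.
rewrite !scale1r in iu iv.
set p := x ^+ (2 ^ N) in iu; set q := (r%:C *: x) ^+ (2 ^ N) in iv.
have q9 : nrm q <= 9^-1.
  apply: le_trans (rnormX _ _) _; rewrite rnormZ x1 mulr1 cabs_real ger0_norm//.
  exact: ltW.
have p1 : nrm p = 1.
  apply/eqP; rewrite eq_le; apply/andP; split.
    by apply: le_trans (rnormX _ _) _; rewrite x1 expr1n.
  by have := rnorm_power_ge 1 (2 ^ N) nx; rewrite !mulr1 x1 rnorm1 !expr1n !mulr1.
have ve : v - 1 = q * v.
  have [+ _] := iv.
  by rewrite mulrBl mul1r => <-; rewrite opprB addrC subrK.
have ue : u - 1 = p * u.
  have [+ _] := iu.
  by rewrite mulrBl mul1r => <-; rewrite opprB addrC subrK.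
(* [|v - 1| <= 1/8], so [|u - 1| <= 3/8] and [|p| <= 3/8 (1 + |p|)]. *)
have hv1 := rnormM q v; rewrite -ve in hv1.
have hv2 := rnormD (v - 1) 1; rewrite subrK rnorm1 in hv2.
have hqv := ler_wpM2r (rnorm_ge0 v) q9.
have hu1 : nrm (u - 1) <= nrm (u - v) + nrm (v - 1).
  by have := rnormD (u - v) (v - 1); rewrite addrA subrK.
have pe : p = (u - 1) - p * (u - 1) by rewrite mulrBr mulr1 -ue opprB addrC subrK.
have hp : nrm p <= nrm (u - 1) + nrm p * nrm (u - 1).
  rewrite {1}pe; apply: le_trans (rnormB _ _) _; rewrite lerD2l; exact: rnormM.
rewrite p1 in hp; lra.
Qed.

Lemma normalZ x (z : R[i]) : normal x -> normal (z *: x).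
Proof.
by move=> nx; rewrite /normal starZ -!scalerAl -!scalerAr nx !scalerA mulrC.
Qed.

Lemma normal_spectral_radius x (M : R) : normal x -> 0 <= M ->
  (forall z, spectrum x z -> cabs z <= M) -> nrm x <= M.
Proof.
move=> nx M0 h; rewrite leNgt; apply/negP => Mx.
have s0 : 0 < nrm x by exact: le_lt_trans Mx.
pose s := (nrm x)%:C.
have sn0 : s != 0 by rewrite -cabs_gt0 cabs_real gtr0_norm.
apply: (@normal_unit_resolvent (s^-1 *: x)); first exact: normalZ.
  by rewrite rnormZ cabsV cabs_real gtr0_norm// mulVf// gt_eqF.
move=> z z1; have [->|z0] := eqVneq z 0.
  by exists 1; rewrite scale0r subr0 mulr1.
have [y [iy yi]] : invertible ((s / z)%:A - x).
  apply: contrapT => /h; rewrite cabsM cabsV cabs_real gtr0_norm//; apply/negP.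
  rewrite -ltNge; apply: lt_le_trans Mx _.
  by rewrite ler_pdivlMr ?cabs_gt0// ger_pMr.
have zs : z / s * (s / z) = 1 by rewrite mulrA mulfVK// divff.
have sz : s / z * (z / s) = 1 by rewrite mulrC.
have e : 1 - z *: (s^-1 *: x) = (z / s) *: ((s / z)%:A - x).
  by rewrite scalerBr !scalerA zs scale1r.
exists ((s / z) *: y); rewrite e -!scalerAl -!scalerAr !scalerA iy yi.
by rewrite zs sz !scale1r.
Qed.

End SpectralRadius.

(** * Completeness and boundedness of the spectrum *)

Section Completeness.
Context (R : realType) (A : cstarAlgType R).
Implicit Types (a b x y : A).
Local Notation nrm := (@rnorm R A).

Lemma geometric_le (q M C r : R) : 0 <= r < 1 ->
  (forall n, q <= M + C * r ^+ n) -> q <= M.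
Proof.
move=> r01 h; apply/ler_addgt0Pr => e e0.
have c0 : 0 < `|C| + 1 by rewrite ltr_wpDl.
have [|N /(_ N (leqnn N)) hN] := expr_eventually_lt r01 (e := e / (`|C| + 1)).
  by rewrite divr_gt0.
apply: le_trans (h N) _; rewrite lerD2l.
rewrite ltr_pdivlMr// in hN; apply: le_trans (ltW hN); rewrite mulrC.
case/andP: r01 => r0 _; rewrite ler_wpM2l ?exprn_ge0//.
by apply: le_trans (ler_norm C) _; rewrite lerDl.
Qed.

(** The explicit rate of convergence spares all later passages to the limit:
    they reduce to [geometric_le]. *)
Lemma geometric_cauchy (u : nat -> A) (C r : R) : 0 <= r < 1 ->
  (forall n k, nrm (u (n + k)%N - u n) <= C * r ^+ n) ->
  exists l, forall n, nrm (l - u n) <= C * r ^+ n.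
Proof.
move=> r01 h; have /cauchy_cvgP/cvg_ex[l ul] : cauchy (u @ \oo).
  apply: cauchy_exP => e e0.
  have er : e = (complex.Re e)%:C by rewrite RRe_real// gtr0_real.
  have c0 : 0 < `|C| + 1 by rewrite ltr_wpDl.
  have [|N /(_ N (leqnn N)) hN] := expr_eventually_lt r01
      (e := complex.Re e / (`|C| + 1)).
    by rewrite divr_gt0// -ltcR -er.
  exists (u N); exists N => // n /= Nn.
  rewrite -ball_normE /= -opprB normrN norm_rnorm er ltcR -(subnKC Nn).
  apply: le_lt_trans (h _ _) _; rewrite ltr_pdivlMr// mulrC in hN.
  apply: le_lt_trans hN; case/andP: r01 => r0 _; rewrite ler_wpM2r ?exprn_ge0//.
  by apply: le_trans (ler_norm C) _; rewrite lerDl.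
exists l => n; apply/ler_addgt0Pl => e e0.
have e0' : 0 < e%:C by rewrite ltcR.
have /cvgrPdist_lt/(_ _ e0')[N _ hN] := ul.
have := hN (n + N)%N (leq_addl _ _); rewrite /= norm_rnorm ltcR => /ltW h1.
have -> : l - u n = (l - u (n + N)%N) + (u (n + N)%N - u n).
  by rewrite addrA subrK.
by apply: le_trans (rnormD _ _) _; exact: lerD.
Qed.

Lemma neumann y : nrm y < 1 -> invertible (1 - y).
Proof.
move=> y1; have r01 : 0 <= nrm y < 1 by rewrite rnorm_ge0.
pose r := nrm y; pose C := (1 - r)^-1.
have r1 : 0 < 1 - r by rewrite subr_gt0.
have Cr : C * (1 - r) = 1 by rewrite mulVf// gt_eqF.
pose s n := \sum_(i < n) y ^+ i.
(* The factor [1 - r^k] makes the induction on [k] close exactly. *)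
have sk n k : nrm (s (n + k)%N - s n) <= C * r ^+ n * (1 - r ^+ k).
  elim: k => [|k IH]; first by rewrite addn0 subrr rnorm0 expr0 subrr mulr0.
  rewrite addnS /s big_ord_recr /= addrAC.
  apply: le_trans (rnormD _ _) _.
  apply: le_trans (lerD IH (rnormX _ _)) _.
  rewrite -/r exprD exprS.
  have : C * r * (r ^+ n * r ^+ k) = C * (r ^+ n * r ^+ k) - r ^+ n * r ^+ k.
    by rewrite -[X in _ - X]mul1r -Cr; ring.
  lra.
have [n k|l hl] := @geometric_cauchy s C r r01.
  apply: le_trans (sk n k) _; rewrite ler_piMr//.
    by rewrite mulr_ge0 ?exprn_ge0 ?rnorm_ge0// invr_ge0 ltW.
  by rewrite gerBl exprn_ge0// rnorm_ge0.
have ys n : (1 - y) * s n = 1 - y ^+ n.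
  by rewrite -[RHS]opprB subrX1 -mulNr opprB.
have sy n : s n * (1 - y) = 1 - y ^+ n.
  rewrite -ys; apply: commr_sym; apply: commr_sum => i _; apply: commrX.
  by apply: commr_sym; apply: commrB; [exact: commr1|exact: commr_refl].
exists l; split; apply/eqP; rewrite -subr_eq0; apply/eqP; apply: rnorm_le0;
  apply: (@geometric_le _ 0 (nrm (1 - y) * C + 1) r) => // n; rewrite add0r.
- have -> : (1 - y) * l - 1 = (1 - y) * (l - s n) - y ^+ n.
    by rewrite mulrBr ys -addrA -opprD subrK.
  apply: le_trans (rnormB _ _) _; rewrite [(_ + 1) * _]mulrDl mul1r lerD ?rnormX//.
  apply: le_trans (rnormM _ _) _; rewrite -mulrA ler_wpM2l ?rnorm_ge0//.
- have -> : l * (1 - y) - 1 = (l - s n) * (1 - y) - y ^+ n.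
    by rewrite mulrBl sy -addrA -opprD subrK.
  apply: le_trans (rnormB _ _) _; rewrite [(_ + 1) * _]mulrDl mul1r lerD ?rnormX//.
  apply: le_trans (rnormM _ _) _; rewrite mulrC -mulrA ler_wpM2l ?rnorm_ge0//.
Qed.

Lemma invertibleZ (c : R[i]) x : c != 0 -> invertible x -> invertible (c *: x).
Proof.
move=> c0 [y [xy yx]]; exists (c^-1 *: y).
by rewrite -!scalerAl -!scalerAr !scalerA xy yx divff// mulVf// scale1r.
Qed.

Lemma spectrum_bounded a z : spectrum a z -> cabs z <= nrm a.
Proof.
move=> az; rewrite leNgt; apply/negP => lt_az; apply: az.
have z0 : z != 0 by rewrite -cabs_gt0 (le_lt_trans _ lt_az) ?rnorm_ge0.
have -> : z%:A - a = z *: (1 - z^-1 *: a).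
  by rewrite scalerBr scalerA divff// scale1r.
apply: invertibleZ => //; apply: neumann.
by rewrite rnormZ cabsV mulrC ltr_pdivrMr ?cabs_gt0// mul1r.
Qed.

End Completeness.

(** * Polynomials in a normal element *)

Section PolynomialCalculus.
Context (R : realType) (A : cstarAlgType R).
Implicit Types (a b x y : A) (p q : {poly R[i]}).
Local Notation nrm := (@rnorm R A).

Lemma comm_horner_alg a y p : GRing.comm y a -> GRing.comm y (horner_alg a p).
Proof.
move=> ya; elim/poly_ind: p => [|p c IH]; first by rewrite rmorph0; exact: commr0.
rewrite rmorphD rmorphM /= horner_algX horner_algC; apply: commrD.
  exact: commrM.
by rewrite /GRing.comm -scalerAl -scalerAr mulr1 mul1r.
Qed.

Lemma comm_star x y : GRing.comm x y -> GRing.comm (star x) (star y).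
Proof. by rewrite /GRing.comm -!star_mul => ->. Qed.

Lemma normal_horner_alg a p : normal a -> normal (horner_alg a p).
Proof.
move=> na; apply: commr_sym; apply: comm_horner_alg; apply: commr_sym.
rewrite -[X in GRing.comm X _]starK; apply: comm_star.
by apply: comm_horner_alg; apply: commr_sym.
Qed.

Lemma invertibleM x y : invertible x -> invertible y -> invertible (x * y).
Proof.
move=> [u [xu ux]] [v [yv vy]]; exists (v * u); split.
  by rewrite mulrA -(mulrA x) yv mulr1.
by rewrite mulrA -(mulrA v) ux mulr1.
Qed.

(** Over the complex numbers [q] splits into linear factors, each of which is
    invertible at [a]. *)
Lemma invertible_horner_alg a q : q != 0 ->
  (forall w, spectrum a w -> q.[w] != 0) -> invertible (horner_alg a q).
Proof.
move=> q0 hq; have [r qr] := closed_field_poly_normal q.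
have : forall w, w \in r -> ~ spectrum a w.
  move=> w wr /hq; rewrite qr hornerZ mulf_eq0 negb_or => /andP[_].
  by rewrite -/(root _ _) root_prod_XsubC wr.
rewrite qr linearZ /= mulr_algl => hr.
have c0 : lead_coef q != 0 by rewrite lead_coef_eq0.
have : invertible (horner_alg a (\prod_(z <- r) ('X - z%:P))).
  elim: r hr {qr} => [|w r IH] hr.
    by rewrite big_nil rmorph1; exists 1; rewrite mulr1.
  rewrite big_cons rmorphM /=; apply: invertibleM; last first.
    by apply: IH => z zr; apply: hr; rewrite in_cons zr orbT.
  have /contrapT[y [iy yi]] := hr w (mem_head _ _).
  exists (- y); rewrite rmorphB /= horner_algX horner_algC.
  by rewrite -opprB mulrNN mulNr mulrN opprK iy yi.
by move=> iP; exact: (invertibleZ c0 iP).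
Qed.

(** An empty spectrum would force the norm of [a] to be [0], and [0] has
    [0] in its spectrum. *)
Lemma spectrum_nonempty a : normal a -> exists w, spectrum a w.
Proof.
move=> na; apply: contrapT => h.
have a0 : a = 0.
  apply: rnorm_le0; apply: normal_spectral_radius => // z az.
  by exfalso; apply: h; exists z.
apply: h; exists 0 => -[y [+ _]].
by rewrite scale0r a0 subr0 mul0r => /esym/eqP; rewrite oner_eq0.
Qed.

(** Spectral mapping for polynomials combined with the spectral radius of the
    normal element [horner_alg a p]. *)
Lemma rnorm_horner_alg a p (M : R) : normal a -> 0 <= M ->
  (forall w, spectrum a w -> cabs p.[w] <= M) -> nrm (horner_alg a p) <= M.
Proof.
move=> na M0 h; apply: normal_spectral_radius => //.
  exact: normal_horner_alg.
move=> z hz; rewrite leNgt; apply/negP => Mz; apply: hz.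
have -> : z%:A - horner_alg a p = horner_alg a (z%:P - p).
  by rewrite rmorphB /= horner_algC.
have ne w : spectrum a w -> (z%:P - p).[w] != 0.
  move=> /h hw; rewrite hornerD hornerN hornerC subr_eq0.
  by apply: contraTneq Mz => ->; rewrite -leNgt.
apply: invertible_horner_alg => //.
(* A spectral point is needed to exclude that [p] is the constant [z]. *)
have [w /ne] := spectrum_nonempty na.
by apply: contraNneq => ->; rewrite horner0.
Qed.

End PolynomialCalculus.

(** * Splitting off the large part of the spectrum *)

Section Splitting.
Context (R : realType) (A : cstarAlgType R).
Implicit Types (a b x y : A) (s : seq R[i]).
Local Notation nrm := (@rnorm R A).

Definition nodal s : {poly R[i]} := \prod_(l <- s) ('X - l%:P).

(** An approximation of the function equal to [0] on [s] and to [1] on any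
    disc around [0] of radius less than all moduli of points of [s]. *)
Definition cutoff s n : {poly R[i]} := \prod_(l <- s) (1 - (l^-1 *: 'X) ^+ n).

Lemma horner_cutoff s n w :
  (cutoff s n).[w] = \prod_(l <- s) (1 - (w / l) ^+ n).
Proof.
rewrite horner_prod; apply: eq_bigr => l _.
by rewrite hornerD hornerN hornerC horner_exp hornerZ hornerX mulrC.
Qed.

Lemma cutoff_root s n w : w != 0 -> w \in s -> (cutoff s n).[w] = 0.
Proof.
move=> w0 ws; rewrite horner_cutoff (big_rem w)//=.
by rewrite divff// expr1n subrr mul0r.
Qed.

Lemma cutoff_near1 s n (t : R) w : 0 <= t <= 1 ->
  (forall l, l \in s -> cabs (w / l) <= t) ->
  cabs ((cutoff s n).[w] - 1) <= (2 ^+ size s - 1) * t ^+ n.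
Proof.
move=> /andP[t0 t1]; rewrite horner_cutoff; elim: s => [|l s IH] h.
  by rewrite big_nil subrr cabs0 expr0 subrr mul0r.
rewrite big_cons; set g := \prod_(_ <- _) _ in IH *.
have {}IH : cabs (g - 1) <= (2 ^+ size s - 1) * t ^+ n.
  by apply: IH => k ks; apply: h; rewrite in_cons ks orbT.
have ul : cabs ((w / l) ^+ n) <= t ^+ n.
  by rewrite cabsX lerXn2r ?nnegrE ?cabs_ge0// h// mem_head.
have tn1 : t ^+ n <= 1 by exact: exprn_ile1.
have s1 : 1 <= (2 : R) ^+ size s by apply: exprn_ege1; lra.
have g2 : cabs g <= 2 ^+ size s.
  have := cabsD (g - 1) 1; rewrite subrK cabs1.
  have := ler_wpM2l (_ : 0 <= 2 ^+ size s - 1) tn1; rewrite subr_ge0 => /(_ s1).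
  lra.
have -> : (1 - (w / l) ^+ n) * g - 1 = (g - 1) - (w / l) ^+ n * g by ring.
apply: le_trans (cabsB _ _) _; rewrite cabsM /= exprS.
have := ler_pM (cabs_ge0 _) (cabs_ge0 _) ul g2; lra.
Qed.

Lemma cabs_nodal s (e : R) w : cabs w <= e ->
  cabs (nodal s).[w] <= \prod_(l <- s) (e + cabs l).
Proof.
move=> we; rewrite horner_prod; elim: s => [|l s IH].
  by rewrite !big_nil cabs1.
rewrite !big_cons cabsM ler_pM ?cabs_ge0//.
by rewrite hornerD hornerN hornerX hornerC (le_trans (cabsB _ _))// lerD2r.
Qed.

(** The finitely many spectral points of modulus in the interval
    from [e / 2], included, to [e], excluded, stay away from [e]. *)
Lemma spectral_gap a (e : R) : 0 < e -> limit_point (spectrum a) `<=` [set 0] ->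
  exists s (e' : R), [/\ uniq s, 0 <= e' < e,
    forall l, l \in s -> e <= cabs l &
    forall w, spectrum a w -> w \in s \/ cabs w <= e'].
Proof.
move=> e0 hacc.
have [|F hF] := finite_off_limit_points (_ : 0 < e / 2) (@spectrum_bounded _ _ a) hacc.
  by rewrite divr_gt0.
exists (undup [seq l <- F | e <= cabs l]).
exists (\big[Order.max/e / 2]_(l <- F | cabs l < e) cabs l); split.
- exact: undup_uniq.
- apply/andP; split.
    by rewrite (le_trans _ (bigmax_ge_id _ _ _ _))// divr_ge0// ltW.
  by apply: bigmax_lt => //; lra.
- by move=> l; rewrite mem_undup mem_filter => /andP[].
move=> w aw; have [we|we] := leP e (cabs w).
  left; rewrite mem_undup mem_filter we hF//.
  by apply: le_trans we; lra.
right; have [we2|we2] := leP (e / 2) (cabs w).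
  by apply: le_bigmax_seq => //; exact: hF.
by apply: le_trans (ltW we2) _; exact: bigmax_ge_id.
Qed.

(** [p] plays the role of the spectral projection of [a] for the open disc
    of radius [e]; it is the limit of the cutoff polynomials at [a], whose
    convergence is uniform on the spectrum at the geometric rate [e' / e]. *)
Lemma spectral_splitting a (e : R) : normal a -> 0 < e ->
  limit_point (spectrum a) `<=` [set 0] ->
  exists s p, [/\ uniq s, horner_alg a (nodal s) * (1 - p) = 0 &
    forall k, nrm (a ^+ k * p) <= e ^+ k].
Proof.
move=> na e0 /(spectral_gap e0)[s [e' [us /andP[e'0 e'e] sl hs]]].
pose t := e' / e; pose K := (2 : R) ^+ size s.
have t01 : 0 <= t < 1.
  by rewrite /t divr_ge0 ?(ltW e0)//= ltr_pdivrMr// mul1r.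
have /andP[t0 t1] := t01.
have K0 : 0 <= K by exact: exprn_ge0.
have vanish w n : w \in s -> (cutoff s n).[w] = 0.
  move=> ws; apply: cutoff_root => //; rewrite -cabs_gt0.
  exact: lt_le_trans (sl _ ws).
have near1 w n : cabs w <= e' -> cabs ((cutoff s n).[w] - 1) <= K * t ^+ n.
  move=> we; apply: le_trans (_ : (K - 1) * t ^+ n <= _); last first.
    by rewrite ler_wpM2r ?exprn_ge0// gerBl.
  apply: cutoff_near1; first by rewrite t0 ltW.
  move=> l /sl el; rewrite cabsM cabsV; apply: ler_pM; rewrite ?cabs_ge0//.
    by rewrite invr_ge0 cabs_ge0.
  by rewrite lef_pV2// posrE (lt_le_trans e0).
pose u n := horner_alg a (cutoff s n).
have cauchy_u n k : nrm (u (n + k)%N - u n) <= 2 * K * t ^+ n.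
  rewrite /u -rmorphB; apply: rnorm_horner_alg => //.
    by rewrite !mulr_ge0// exprn_ge0.
  move=> w /hs[ws|we]; rewrite hornerD hornerN.
    by rewrite !vanish// subrr cabs0 !mulr_ge0// exprn_ge0.
  have -> : forall v z : R[i], v - z = (v - 1) - (z - 1).
    by move=> v z; rewrite opprB addrA subrK.
  apply: le_trans (cabsB _ _) _.
  apply: le_trans (lerD (near1 _ _ we) (near1 _ _ we)) _.
  have : t ^+ (n + k) <= t ^+ n.
    by rewrite exprD ler_piMr ?exprn_ge0// exprn_ile1// ltW.
  by move/(ler_wpM2l K0); lra.
have [p hp] := geometric_cauchy t01 cauchy_u.
exists s, p; split => //.
- apply: rnorm_le0; pose B := \prod_(l <- s) (e' + cabs l).
  have B0 : 0 <= B by apply: prodr_ge0 => l _; rewrite addr_ge0// cabs_ge0.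
  pose N := horner_alg a (nodal s).
  apply: (@geometric_le _ _ 0 (B * K + nrm N * (2 * K)) t) => // n; rewrite add0r.
  have -> : N * (1 - p) = N * (1 - u n) - N * (p - u n).
    by rewrite -mulrBr opprB addrA subrK.
  apply: le_trans (rnormB _ _) _; rewrite [(_ + _) * _]mulrDl lerD//.
    have -> : N * (1 - u n) = horner_alg a (nodal s * (1 - cutoff s n)).
      by rewrite rmorphM rmorphB rmorph1.
    apply: rnorm_horner_alg => //; first by rewrite !mulr_ge0// exprn_ge0.
    move=> w /hs[ws|we]; rewrite hornerM cabsM.
      rewrite (_ : (nodal s).[w] = 0) ?cabs0 ?mul0r ?mulr_ge0 ?exprn_ge0//.
      by apply/eqP; rewrite -/(root _ _) root_prod_XsubC.
    rewrite -mulrA; apply: ler_pM; rewrite ?cabs_ge0//; first exact: cabs_nodal.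
    by rewrite hornerD hornerN hornerC cabsBC near1.
  by apply: le_trans (rnormM _ _) _; rewrite -mulrA ler_wpM2l ?rnorm_ge0.
- move=> k; apply: (@geometric_le _ _ _ (e ^+ k * K + nrm (a ^+ k) * (2 * K)) t) => // n.
  have -> : a ^+ k * p = a ^+ k * u n + a ^+ k * (p - u n).
    by rewrite -mulrDr addrC subrK.
  apply: le_trans (rnormD _ _) _; rewrite [(_ + _) * _]mulrDl addrA lerD//.
    have -> : a ^+ k * u n = horner_alg a ('X ^+ k * cutoff s n).
      by rewrite rmorphM rmorphXn /= horner_algX.
    have bnd : 0 <= e ^+ k + e ^+ k * K * t ^+ n.
      by rewrite addr_ge0 ?mulr_ge0 ?exprn_ge0// ltW.
    apply: rnorm_horner_alg => //.
    move=> w /hs[ws|we]; rewrite hornerM cabsM hornerXn cabsX.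
      by rewrite vanish// cabs0 mulr0.
    rewrite -mulrA -[X in X + _]mulr1 -mulrDr.
    apply: ler_pM; rewrite ?exprn_ge0 ?cabs_ge0//.
      by rewrite lerXn2r ?nnegrE ?cabs_ge0 ?ltW// (le_lt_trans we).
    have := cabsD ((cutoff s n).[w] - 1) 1; rewrite subrK cabs1 addrC => h.
    by apply: le_trans h _; rewrite lerD2l near1.
  by apply: le_trans (rnormM _ _) _; rewrite -mulrA ler_wpM2l ?rnorm_ge0.
Qed.

(** The nodes being distinct, Bezout splits [x] into a part killed by
    [a - l] and a part killed by the remaining factors. *)
Lemma kernel_transfer a b x s : normal b ->
  subgeometric_commutators b a -> uniq s ->
  horner_alg a (nodal s) * x = 0 -> b * x = a * x.
Proof.
move=> nb ba; elim: s x => [|l s IH] x.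
  by move=> _; rewrite /nodal big_nil rmorph1 mul1r => ->; rewrite !mulr0.
rewrite /= => /andP[ls us] Px.
have {}Px (w : {poly R[i]}) :
    horner_alg a (w * (('X - l%:P) * nodal s)) * x = 0.
  by rewrite rmorphM -mulrA [X in _ * X](_ : _ = 0) ?mulr0// -Px /nodal big_cons.
have /Bezout_eq1_coprimepP[[u v] /= uv] : coprimep ('X - l%:P) (nodal s).
  by rewrite coprimep_sym coprimep_XsubC root_prod_XsubC.
have hX : horner_alg a ('X - l%:P) = a - l%:A.
  by rewrite rmorphB /= horner_algX horner_algC.
have -> : x = horner_alg a (u * ('X - l%:P)) * x +
    horner_alg a (v * nodal s) * x.
  by rewrite -mulrDl -rmorphD uv rmorph1 mul1r.
rewrite !mulrDr; congr (_ + _).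
  apply: IH => //; rewrite mulrA -rmorphM.
  by rewrite -[RHS](Px u); congr (horner_alg a _ * x); ring.
set y := horner_alg a (v * nodal s) * x.
have ay : a * y = l *: y.
  apply/eqP; rewrite -subr_eq0; apply/eqP.
  have <- : (a - l%:A) * y = a * y - l *: y by rewrite mulrBl -scalerAl mul1r.
  rewrite -hX mulrA -rmorphM.
  by rewrite -[RHS](Px v); congr (horner_alg a _ * x); ring.
by rewrite ay; exact: eigen_transfer ay.
Qed.

Lemma subgeometric_eq a b : normal a -> normal b ->
  limit_point (spectrum a) `<=` [set 0] -> subgeometric_commutators b a -> a = b.
Proof.
move=> na nb hacc ba; apply/eqP; rewrite -subr_eq0; apply/eqP; apply: rnorm_le0.
apply/ler_addgt0Pl => e e0; rewrite addr0.
have e2 : 0 < e / 2 by rewrite divr_gt0.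
have [s [p [us Pp pk]]] := spectral_splitting na e2 hacc.
have := kernel_transfer nb ba us Pp => abp.
have -> : a - b = (a - b) * p.
  apply/eqP; rewrite -subr_eq0 -{1}[a - b]mulr1 -mulrBr mulrBl abp.
  by rewrite subrr.
have bp : nrm (b * p) <= e / 2 * nrm p.
  apply: (@growth_transfer _ _ a _ _ _ 1) => //; first exact: ltW.
  by move=> k; rewrite mul1r.
have p1 : nrm p <= 1 by have := pk 0; rewrite !expr0 mul1r.
have ap : nrm (a * p) <= e / 2 by have := pk 1; rewrite !expr1.
rewrite mulrBl; apply: le_trans (rnormB _ _) _.
have := ler_wpM2l (ltW e2) p1; lra.
Qed.

End Splitting.

(** * The quasi-distance of an element to itself *)

Section Rho.
Context (R : realType) (A : cstarAlgType R).
Implicit Types (a b : A).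

Lemma rho_ge0 a b : (0 <= rho a b)%E.
Proof.
apply: le_ereal_inf_tmp => _ [V [N _ NV] <-].
apply: (@le_trans _ _ ((rnorm (iter N (C_op a b) 1) `^ N%:R^-1)%:E)).
  by rewrite lee_fin powR_ge0.
by apply: ereal_sup_ubound; exists N => //; apply: NV => /=.
Qed.

Lemma rho_self a : rho a a = 0%E.
Proof.
apply/eqP; rewrite eq_le rho_ge0 andbT.
apply: (@le_trans _ _ (ereal_sup
    [set (rnorm (iter n (C_op a a) 1) `^ n%:R^-1)%:E | n in [set n | (0 < n)%N]])).
  by apply: ereal_inf_lbound; exists [set n | (0 < n)%N] => //; exists 1%N.
have C0 : C_op a a 0 = 0 by rewrite /C_op mulr0 mul0r subrr.
have C1 n : iter n.+1 (C_op a a) 1 = 0.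
  by elim: n => [|n IH]; [rewrite /= /C_op mulr1 mul1r subrr | rewrite iterS IH].
apply: ge_ereal_sup => _ [[|n] // _ <-].
by rewrite C1 rnorm0 powR0// invr_eq0 pnatr_eq0.
Qed.

End Rho.

Theorem theorem5p2 (R : realType) (A : cstarAlgType R) (a b : A)
    (ha : normal a) (hb : normal b)
    (hacc : limit_point (spectrum a) `<=` [set 0]) :
  quasi_dist a b = 0%E <-> a = b.
Proof.
split=> [d0|->]; last by rewrite /quasi_dist rho_self maxxx.
apply: subgeometric_eq => //; apply: rho_le0_subgeometric.
have : (rho b a <= quasi_dist a b)%E by rewrite /quasi_dist le_max lexx orbT.
by rewrite d0.
Qed.
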